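(* Let $n\ge 1$, let $a\in\{0,1\}^n$ be nonzero, and let $f:\{0,1\}^n\to\{0,1\}^n$ be a 2-to-1 function such that for all $x\ne y$: $f(x)=f(y)\Leftrightarrow y=x\oplus a$. Assume that $f$ is not constant. Then Simon's algorithm executed on $f$ generates entanglement, that is, for every possible outcome of its intermediate measurement, at least one of the states $|\psi_0\rangle,\dots,|\psi_4\rangle$ occurring in the execution is entangled.
   Context: $\oplus$ is bitwise XOR, and $x\cdot y=\sum_i x_iy_i\bmod 2$. Such an $f$ is an instance of Simon's problem; the string $a$ is called the period. A pure state of $m$ qubits (unit vector in $(\mathbb{C}^2)^{\otimes m}$) is separable if it is a tensor product of $m$ single-qubit states; otherwise it is entangled. Simon's algorithm on $f$ goes through the following states: $|\psi_0\rangle=|0\rangle^{\otimes n}|0\rangle^{\otimes n}$ ($2n$ qubits); $|\psi_1\rangle=\frac{1}{\sqrt{2^n}}\sum_{x\in\{0,1\}^n}|x\rangle|0\rangle^{\otimes n}$ (after Hadamard gates on the first $n$ qubits); $|\psi_2\rangle=\frac{1}{\sqrt{2^n}}\sum_{x\in\{0,1\}^n}|x\rangle|f(x)\rangle$ (after applying the oracle of $f$); the last $n$ qubits are then measured in the computational basis, giving an outcome $f(x_0)$ and leaving the $n$-qubit state $|\psi_3\rangle=\frac{1}{\sqrt2}(|x_0\rangle+|x_0\oplus a\rangle)$; $|\psi_4\rangle=\frac{1}{2^{(n-1)/2}}\sum_{y:\,a\cdot y=0}(-1)^{x_0\cdot y}|y\rangle$ (after Hadamard gates on these $n$ qubits).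 *)

(* Defs.v *)
From HB Require Import structures.
From mathcomp Require Import all_boot all_order all_algebra.

Set Implicit Arguments.
Unset Strict Implicit.
Unset Printing Implicit Defensive.

Import Order.TTheory GRing.Theory Num.Theory.
Local Open Scope ring_scope.

(* In MathComp, bool is the field with two elements: its addition is xor and
   its multiplication is conjunction.  Hence x + y on bit strings is the bitwise
   xor, and the sum in bdot is taken modulo 2. *)
Notation bits n := 'rV[bool]_n.

Definition bdot n (x y : bits n) : bool := \sum_i x 0 i * y 0 i.

Definition two_to_one n (f : bits n -> bits n) : Prop :=
  forall x, #|[set x' | f x' == f x]| = 2%N.

Definition simon_instance n (a : bits n) (f : bits n -> bits n) : Prop :=
  two_to_one f /\ (forall x y, x != y -> (f x = f y <-> y = x + a)).

Definition constant_fun n (f : bits n -> bits n) : Prop :=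
  exists c, forall x, f x = c.

(* Vectors are given by their coordinates in the computational basis; C^o is
   the scalar field C seen as a module over itself. *)
Definition qubit (C : numClosedFieldType) := {ffun bool -> C^o}.
Definition state (C : numClosedFieldType) m := {ffun bits m -> C^o}.

Definition ket {C : numClosedFieldType} {T : finType} (t : T) :
  {ffun T -> C^o} := [ffun s => (s == t)%:R].

Definition unit_vector {C : numClosedFieldType} {T : finType}
  (psi : {ffun T -> C^o}) : Prop := \sum_t `|psi t : C| ^+ 2 = 1.

Definition tensor {C : numClosedFieldType} m (phi : 'I_m -> qubit C) :
  state C m := [ffun x : bits m => \prod_i (phi i (x 0 i) : C)].

Definition separable_state {C : numClosedFieldType} m (psi : state C m) : Prop :=
  exists phi : 'I_m -> qubit C,
    (forall i, unit_vector (phi i)) /\ psi = tensor phi.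

Definition entangled {C : numClosedFieldType} m (psi : state C m) : Prop :=
  unit_vector psi /\ ~ separable_state psi.

(* A linear operator is given by the images U b of the basis vectors |b>. *)
Definition apply_op {C : numClosedFieldType} m (U : bits m -> state C m)
  (psi : state C m) : state C m := \sum_b psi b *: U b.

Definition hadamard {C : numClosedFieldType} (b : bool) : qubit C :=
  (sqrtC 2)^-1 *: (ket false + (-1) ^+ b *: ket true).

Definition hadamard_all {C : numClosedFieldType} n (x : bits n) : state C n :=
  tensor (fun i => hadamard (x 0 i)).

Definition hadamard_first {C : numClosedFieldType} n k (w : bits (n + k)) :
  state C (n + k) :=
  tensor (fun i => if (i < n)%N then hadamard (w 0 i) else ket (w 0 i)).

Definition oracle {C : numClosedFieldType} n (f : bits n -> bits n)
  (w : bits (n + n)) : state C (n + n) :=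
  ket (row_mx (lsubmx w) (rsubmx w + f (lsubmx w))).

(* Measurement of the last k of n + k qubits: the probability of the outcome z,
   and the state of the first n qubits after that outcome. *)
Definition outcome_prob {C : numClosedFieldType} n k (psi : state C (n + k))
  (z : bits k) : C := \sum_(x : bits n) `|psi (row_mx x z) : C| ^+ 2.

Definition post_measurement {C : numClosedFieldType} n k
  (psi : state C (n + k)) (z : bits k) : state C n :=
  (sqrtC (outcome_prob psi z))^-1 *: [ffun x => psi (row_mx x z)].

Definition psi0 (C : numClosedFieldType) n : state C (n + n) :=
  ket (row_mx 0 0).

Definition psi1 (C : numClosedFieldType) n : state C (n + n) :=
  apply_op (@hadamard_first C n n) (psi0 C n).

Definition psi2 (C : numClosedFieldType) n (f : bits n -> bits n) :
  state C (n + n) := apply_op (oracle f) (psi1 C n).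

Definition possible_outcome (C : numClosedFieldType) n (f : bits n -> bits n)
  (z : bits n) : Prop := 0 < outcome_prob (psi2 C f) z.

Definition psi3 (C : numClosedFieldType) n (f : bits n -> bits n) (z : bits n) :
  state C n := post_measurement (psi2 C f) z.

Definition psi4 (C : numClosedFieldType) n (f : bits n -> bits n) (z : bits n) :
  state C n := apply_op (@hadamard_all C n) (psi3 C f z).

Lemma apply_op_ket (C : numClosedFieldType) m (U : bits m -> state C m) b :
  apply_op U (ket b) = U b.
Proof.
rewrite /apply_op (bigD1 b) //= big1 ?addr0 => [|c /negbTE cb];
  by rewrite ffunE ?eqxx ?cb ?scale1r ?scale0r.
Qed.

Lemma apply_op_sum (C : numClosedFieldType) m (U : bits m -> state C m)
    (I : finType) (P : pred I) (F : I -> state C m) :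
  apply_op U (\sum_(i | P i) F i) = \sum_(i | P i) apply_op U (F i).
Proof.
rewrite /apply_op exchange_big /=; apply: eq_bigr => b _.
by rewrite sum_ffunE scaler_suml.
Qed.

Lemma apply_opD (C : numClosedFieldType) m (U : bits m -> state C m) u v :
  apply_op U (u + v) = apply_op U u + apply_op U v.
Proof.
rewrite /apply_op -big_split /=; apply: eq_bigr => b _.
by rewrite ffunE scalerDl.
Qed.

Lemma apply_opZ (C : numClosedFieldType) m (U : bits m -> state C m) c u :
  apply_op U (c *: u) = c *: apply_op U u.
Proof.
rewrite /apply_op scaler_sumr; apply: eq_bigr => b _.
by rewrite ffunE scalerA.
Qed.

Lemma hadamardE (C : numClosedFieldType) b c :
  @hadamard C b c = (sqrtC 2)^-1 * (-1) ^+ (b && c).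
Proof.
rewrite !ffunE; congr (_ * _).
by case: b; case: c; rewrite /= ?expr1 ?expr0 /GRing.scale /= ?mulr0 ?mulr1
  ?addr0 ?add0r.
Qed.

Lemma sqrtC2X (C : numClosedFieldType) n :
  (sqrtC (2 ^+ n : C))^-1 = (sqrtC 2)^-1 ^+ n.
Proof. by rewrite rootCX ?ler0n // exprVn. Qed.

Lemma bdot_sign (C : numClosedFieldType) n (x y : bits n) :
  (-1 : C) ^+ bdot x y = \prod_i (-1) ^+ (x 0 i && y 0 i).
Proof.
pose g (b : bool) : C := (-1) ^+ b.
have gD : {morph g : b c / b + c >-> b * c} by move=> b c; exact: signr_addb.
have g0 : g 0 = 1 by rewrite /g expr0.
exact: (big_morph g gD g0).
Qed.

Lemma bdotDl n (x x' y : bits n) : bdot (x + x') y = bdot x y (+) bdot x' y.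
Proof.
rewrite /bdot -[RHS]/(_ + _) -big_split /=; apply: eq_bigr => i _.
by rewrite mxE mulrDl.
Qed.

Lemma hadamard_allE (C : numClosedFieldType) n (x y : bits n) :
  @hadamard_all C n x y = (sqrtC (2 ^+ n))^-1 * (-1) ^+ bdot x y.
Proof.
rewrite ffunE bdot_sign sqrtC2X.
rewrite (eq_bigr (fun i => (sqrtC 2)^-1 * (-1) ^+ (x 0 i && y 0 i))); last first.
  by move=> i _; rewrite hadamardE.
by rewrite big_split /= prodr_const card_ord.
Qed.

Lemma psi1E (C : numClosedFieldType) n :
  psi1 C n = (sqrtC (2 ^+ n))^-1 *: \sum_(x : bits n) ket (row_mx x 0).
Proof.
rewrite /psi1 /psi0 apply_op_ket; apply/ffunP => w.
rewrite -[w]hsubmxK; move: (lsubmx w) (rsubmx w) => u v {w}.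
rewrite ffunE big_split_ord /= !ffunE sum_ffunE.
rewrite (eq_bigr (fun=> (sqrtC 2)^-1 : C)); last first.
  move=> i _; rewrite ltn_ord !row_mxEl mxE hadamardE andFb expr0 mulr1.
  by [].
rewrite prodr_const card_ord -sqrtC2X; congr (_ * _).
rewrite (eq_bigr (fun i => (v 0 i == 0)%:R : C)); last first.
  by move=> i _; rewrite ltnNge leq_addr /= !row_mxEr mxE ffunE.
rewrite [RHS](bigD1 u) //= [X in _ = _ + X]big1 ?addr0 => [|x /negbTE xu];
  last first.
  rewrite ffunE; case: eqP => // /eq_row_mx [ux _].
  by rewrite ux eqxx in xu.
rewrite ffunE; case: eqP => [/eq_row_mx [_ ->]|nv].
  by rewrite big1 // => i _; rewrite mxE eqxx.
have [i vi] : exists i, v 0 i != 0.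
  apply/existsP; apply: contra_notT nv; rewrite negb_exists => /forallP v0.
  congr row_mx; apply/rowP => i; rewrite mxE; apply/eqP.
  by have := v0 i; rewrite negbK.
by rewrite (bigD1 i) //= (negbTE vi) mul0r.
Qed.

Lemma psi2E (C : numClosedFieldType) n (f : bits n -> bits n) :
  psi2 C f = (sqrtC (2 ^+ n))^-1 *: \sum_(x : bits n) ket (row_mx x (f x)).
Proof.
rewrite /psi2 psi1E apply_opZ apply_op_sum; congr (_ *: _).
apply: eq_bigr => x _; rewrite apply_op_ket /oracle row_mxKl row_mxKr.
by rewrite add0r.
Qed.

Lemma psi2_coef (C : numClosedFieldType) n (f : bits n -> bits n) x z :
  psi2 C f (row_mx x z) = (sqrtC (2 ^+ n))^-1 * (f x == z)%:R.
Proof.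
rewrite psi2E ffunE sum_ffunE; congr (_ * _).
rewrite (bigD1 x) //= big1 ?addr0 => [|y /negbTE yx].
  rewrite ffunE; congr (_%:R); congr nat_of_bool.
  by apply/eqP/eqP => [/eq_row_mx []|->].
rewrite ffunE; case: eqP => // /eq_row_mx [xy _].
by rewrite xy eqxx in yx.
Qed.

Lemma outcome_probE (C : numClosedFieldType) n (f : bits n -> bits n) z :
  outcome_prob (psi2 C f) z = #|[set x | f x == z]|%:R / 2 ^+ n.
Proof.
have -> : #|[set x | f x == z]| = (\sum_x (f x == z : nat))%N.
  by rewrite -sum1dep_card big_mkcond; apply: eq_bigr => x _; case: (f x == z).
rewrite /outcome_prob natr_sum mulrC mulr_sumr; apply: eq_bigr => x _.
rewrite psi2_coef.
rewrite ger0_norm ?mulr_ge0 ?invr_ge0 ?sqrtC_ge0 ?exprn_ge0 ?ler0n //.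
by rewrite exprMn exprVn sqrtCK; case: (f x == z); rewrite ?expr1n ?expr0n.
Qed.

Lemma possible_outcomeP (C : numClosedFieldType) n (f : bits n -> bits n) z :
  possible_outcome C f z <-> exists x0, z = f x0.
Proof.
rewrite /possible_outcome outcome_probE pmulr_lgt0 ?invr_gt0 ?exprn_gt0 ?ltr0n //.
rewrite card_gt0; split => [/set0Pn [x]|[x ->]].
  by rewrite inE => /eqP <-; exists x.
by apply/set0Pn; exists x; rewrite inE.
Qed.

Lemma psi3E (C : numClosedFieldType) n (a : bits n) f x0 :
  a != 0 -> simon_instance a f ->
  psi3 C f (f x0) = (sqrtC 2)^-1 *: (ket x0 + ket (x0 + a)).
Proof.
move=> a0 [f2 fa]; rewrite /psi3 /post_measurement outcome_probE f2.
apply/ffunP => x; rewrite !ffunE psi2_coef.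
rewrite /GRing.scale /= mulrA; congr (_ * _).
  rewrite -invfM; congr (_^-1).
  by rewrite -rootCMl ?divr_ge0 ?exprn_ge0 ?ler0n // divfK // expf_neq0 ?pnatr_eq0.
have xa : x0 + a != x0 by rewrite -subr_eq0 addrC addKr.
case: (eqVneq x x0) => [->|xx0].
  by rewrite eqxx eq_sym (negbTE xa) addr0.
rewrite add0r; congr (_%:R); congr nat_of_bool.
have := fa x0 x; rewrite eq_sym xx0 => /(_ isT) h.
by apply/eqP/eqP => [/esym /h|/h].
Qed.

Lemma psi4E (C : numClosedFieldType) n (a : bits n) f x0 :
  (0 < n)%N -> a != 0 -> simon_instance a f ->
  psi4 C f (f x0) =
    (sqrtC (2 ^+ n.-1))^-1 *:
      \sum_(y | bdot a y == 0) (-1) ^+ bdot x0 y *: ket y.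
Proof.
move=> n0 a0 fa; rewrite /psi4 (psi3E _ _ a0 fa) apply_opZ apply_opD.
rewrite !apply_op_ket; apply/ffunP => y; rewrite [LHS]ffunE [X in _ *: X]ffunE.
rewrite !hadamard_allE ffunE sum_ffunE bdotDl signr_addb /GRing.scale /=.
transitivity ((sqrtC (2 ^+ n.-1) : C)^-1 *
              (if bdot a y == 0 then (-1) ^+ bdot x0 y else 0)).
  case: ifP => [/eqP -> | ]; last first.
    case: (bdot a y) => // _.
    by rewrite /= expr1 mulrN1 mulrN subrr !mulr0.
  rewrite expr0 mulr1 -mulr2n -[_ * _ *+ 2]mulr_natl !mulrA; congr (_ * _).
  rewrite !sqrtC2X -{1}(prednK n0) exprS.
  rewrite -[X in _ * X * _](sqrtCK 2) expr2.
  have s0 : sqrtC 2 != 0 :> C by rewrite sqrtC_eq0 pnatr_eq0.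
  by rewrite mulrA mulVf // mul1r mulrA mulfV // mul1r.
congr (_ * _); case: ifP => ay; last first.
  rewrite big1 // => z az; rewrite !ffunE; case: eqP => [yz|_].
    by rewrite yz az in ay.
  by rewrite /GRing.scale /= mulr0.
rewrite (bigD1 y) //= big1 ?addr0 => [|z /andP [_ /negbTE zy]].
  by rewrite !ffunE eqxx /GRing.scale /= mulr1.
by rewrite !ffunE eq_sym zy /GRing.scale /= mulr0.
Qed.

(* Main.v *)
(** If a state separable across the two registers has nonzero amplitudes at
    [(x, z)] and [(x', z')], then it also has one at [(x, z')].  The amplitude of
    [psi2] is nonzero exactly on the graph of [f], which is not closed under
    this exchange unless [f] is constant; so [psi2] is already entangled. *)
Require Import Defs.
From mathcomp Require Import all_boot all_order all_algebra.
From mathcomp Require Import reals.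
From mathcomp Require Import complex.
Import Order.TTheory GRing.Theory Num.Theory.
Local Open Scope ring_scope.

(** A product amplitude at [(u, v)] factors as [g u * h v], so both sides consist of the same four
    factors. *)
Lemma separable_exchange (C : numClosedFieldType) n k (psi : state C (n + k))
    (x x' : bits n) (z z' : bits k) :
  separable_state psi ->
  (psi (row_mx x z) : C) * psi (row_mx x' z') =
    (psi (row_mx x z') : C) * psi (row_mx x' z).
Proof.
have tensorE (phi : 'I_(n + k) -> qubit C) (u : bits n) (v : bits k) :
    tensor phi (row_mx u v) =
      (\prod_i (phi (lshift k i) (u 0 i) : C)) *
      \prod_i (phi (rshift n i) (v 0 i) : C).
  rewrite ffunE big_split_ord; congr (_ * _); apply: eq_bigr => i _.
    by rewrite row_mxEl.
  by rewrite row_mxEr.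
by move=> [phi [_ ->]]; rewrite !tensorE mulrACA [X in _ * X]mulrC mulrACA.
Qed.

Lemma sum_bits_row_mx (V : nmodType) n k (F : bits (n + k) -> V) :
  \sum_w F w = \sum_(x : bits n) \sum_(z : bits k) F (row_mx x z).
Proof.
rewrite pair_bigA /=.
rewrite (reindex (fun p : bits n * bits k => row_mx p.1 p.2)) //=.
exists (fun w => (lsubmx w, rsubmx w)) => [[u v]|w] _ /=.
  by rewrite row_mxKl row_mxKr.
exact: hsubmxK.
Qed.

(** For each [x] only [z = f x] contributes, with squared modulus [(2 ^+ n)^-1], and there are
    [2 ^+ n] strings [x]. *)
Lemma psi2_unit (C : numClosedFieldType) n (f : bits n -> bits n) :
  unit_vector (psi2 C f).
Proof.
rewrite /unit_vector sum_bits_row_mx.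
rewrite (eq_bigr (fun=> (2 ^+ n)^-1 : C)) => [|x _].
  rewrite sumr_const card_mx card_bool mul1n -[LHS]mulr_natl natrX mulfV //.
  by rewrite expf_neq0 ?pnatr_eq0.
rewrite (bigD1 (f x)) //= big1 ?addr0 => [|z /negbTE zf]; rewrite psi2_coef.
  rewrite eqxx mulr1 ger0_norm ?invr_ge0 ?sqrtC_ge0 ?exprn_ge0 ?ler0n //.
  by rewrite exprVn sqrtCK.
by rewrite eq_sym zf mulr0 normr0 expr0n.
Qed.

Lemma psi2_separable_constant (C : numClosedFieldType) n
    (f : bits n -> bits n) :
  separable_state (psi2 C f) -> constant_fun f.
Proof.
move=> sep; exists (f 0) => x; apply/eqP; apply: contraT => /negbTE fx.
(* The left side is a product of two nonzero amplitudes; the right side vanishes because [f x]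
   differs from [f 0]. *)
have := separable_exchange _ _ _ _ x 0 (f x) (f 0) sep.
rewrite !psi2_coef !eqxx fx mulr0 mul0r mulr1 => /eqP.
by rewrite mulf_eq0 orbb invr_eq0 sqrtC_eq0 expf_eq0 pnatr_eq0 andbF.
Qed.

Theorem proposition3p1 (R : realType) (n : nat) (hn : (1 <= n)%N)
    (a : bits n) (ha : a != 0) (f : bits n -> bits n)
    (hf : simon_instance a f) (hnc : ~ constant_fun f) :
  forall z : bits n, possible_outcome R[i] f z ->
    entangled (psi0 R[i] n) \/ entangled (psi1 R[i] n) \/
    entangled (psi2 R[i] f) \/ entangled (psi3 R[i] f z) \/
    entangled (psi4 R[i] f z).
Proof.
(* [psi2] precedes the measurement, so it serves for every outcome [z]. *)
move=> z _; right; right; left; split; first exact: psi2_unit.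
by move=> /psi2_separable_constant.
Qed.
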